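(* Let $\mathcal H^2$ be a two-dimensional complex Hilbert space with orthonormal basis $h_{01},h_{02}$, and let $\lambda_1,\lambda_2,\mu_1,\mu_2\in\mathbb C$ be fixed numbers such that $\operatorname{Im}\lambda_1>0$ and $\operatorname{Im}\lambda_2>0$. For $j=1,2$ let $T_j$ be the linear operator in $\mathcal H^2$ with matrix $\begin{pmatrix}\lambda_j&0\\0&\mu_j\end{pmatrix}$ in this basis, let $K_j:\mathbb C^2\to\mathcal H^2$ be given by $K_j(c_1,c_2)^T=\sqrt{\operatorname{Im}\lambda_j}\,c_1h_{01}+\sqrt{\operatorname{Im}\mu_j}\,c_2h_{02}$, with $K_j^*:\mathcal H^2\to\mathbb C^2$ acting as $K_j^*(c_1h_{01}+c_2h_{02})=(\sqrt{\operatorname{Im}\lambda_j}\,c_1,\sqrt{\operatorname{Im}\mu_j}\,c_2)^T$, let $J=I$ be the identity on $\mathbb C^2$ (so that $K_jJK_j^*=\operatorname{Im}T_j$), and consider the L-systems $$\Theta_1=\begin{pmatrix}T_1&K_1&J\\ \mathcal H^2&&\mathbb C^2\end{pmatrix},\qquad \Theta_2=\begin{pmatrix}T_2&K_2&J\\ \mathcal H^2&&\mathbb C^2\end{pmatrix}.$$ Let the L-system $\Theta=\Theta_1\cdot\Theta_2$ be the coupling of $\Theta_1$ and $\Theta_2$. If $z\in\rho(T_1)\cap\rho(T_2)=\mathbb C\setminus\{\lambda_1,\lambda_2,\mu_1,\mu_2\}$, then $$W_\Theta(z)=W_{\Theta_1}(z)\cdot W_{\Theta_2}(z)=\begin{p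matrix}\dfrac{\bar\lambda_1-z}{\lambda_1-z}\cdot\dfrac{\bar\lambda_2-z}{\lambda_2-z}&0\\0&\dfrac{\bar\mu_1-z}{\mu_1-z}\cdot\dfrac{\bar\mu_2-z}{\mu_2-z}\end{pmatrix}.$$
   Context: $\operatorname{Im}T=\frac1{2i}(T-T^* )$. A canonical L-system is an array $\Theta=\begin{pmatrix}T&K&J\\ \mathcal H&&E\end{pmatrix}$, where $\mathcal H,E$ are Hilbert spaces with $\dim E<\infty$, $T$ is a bounded operator in $\mathcal H$ (main operator), $K:E\to\mathcal H$ is bounded (channel operator), $J$ is a bounded self-adjoint unitary operator in $E$ (directing operator), and $\operatorname{Im}T=KJK^*$. Its transfer function is $W_\Theta(z)=I-2iK^*(T-zI)^{-1}KJ$, $z\in\rho(T)$. The coupling $\Theta=\Theta_1\cdot\Theta_2$ of $\Theta_1=\begin{pmatrix}T_1&K_1&J\\ \mathcal H^2&&\mathbb C^2\end{pmatrix}$ and $\Theta_2=\begin{pmatrix}T_2&K_2&J\\ \mathcal H^2&&\mathbb C^2\end{pmatrix}$ (with $J=I$) is the L-system $\Theta=\begin{pmatrix}\mathbf T&\mathbf K&J\\ \mathcal H^2\oplus\mathcal H^2&&\mathbb C^2\end{pmatrix}$, where $\mathbf T=\begin{pmatrix}T_1&2iK_1JK_2^*\\0&T_2\end{pmatrix}$ on $\mathcal H^2\oplus\mathcal H^2$ and $\mathbf K:\mathbb C^2\to\mathcal H^2\oplus\mathcal H^2$, $\mathbf K\mathbf c=(K_1\mathbf c,K_2\mathbf c)$,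 with $\mathbf K^*(\mathbf h_1,\mathbf h_2)=K_1^*\mathbf h_1+K_2^*\mathbf h_2$. *)

(* Defs.v *)
From HB Require Import structures.
From mathcomp Require Export all_boot all_order all_algebra.
From mathcomp Require Export sesquilinear.
From mathcomp Require Export complex.
From mathcomp Require Export boolp classical_sets reals.

Set Implicit Arguments.
Unset Strict Implicit.
Unset Printing Implicit Defensive.

Import Order.TTheory GRing.Theory Num.Theory.
Local Open Scope ring_scope.
Local Open Scope classical_set_scope.

(* A finite-dimensional complex Hilbert space is a vectType over C together
   with an inner product d : {dot H for conjC}, linear in its first argument
   and conjugate-linear in the second.  Completeness of H and boundedness of
   linear operators are automatic in finite dimension. *)

Section Hilbert.
Variable C : numClosedFieldType.

Section StdDot.
Variable n : nat.
Implicit Types x y : 'cV[C]_n.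

Definition std_dot x y : C := \sum_(i < n) x i 0 * (y i 0)^*.

Let std_dot_bilinear : bilinear_for *%R (Num.conj \; *%R) std_dot.
Proof.
split=> u a x y /=; rewrite /std_dot mulr_sumr -big_split /=;
  apply: eq_bigr => i _; rewrite !mxE.
  by rewrite mulrDl mulrA.
by rewrite rmorphD rmorphM mulrDr /= mulrCA.
Qed.
HB.instance Definition _ := bilinear_isBilinear.Build C 'cV[C]_n 'cV[C]_n C
  *%R (Num.conj \; *%R) std_dot std_dot_bilinear.

Let std_dot_herm x y : std_dot x y = (-1) ^+ false * (std_dot y x)^*.
Proof.
rewrite expr0 mul1r /std_dot rmorph_sum; apply: eq_bigr => i _.
by rewrite rmorphM /= conjCK mulrC.
Qed.
HB.instance Definition _ := isHermitianSesquilinear.Build C 'cV[C]_n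
  false Num.conj std_dot std_dot_herm.

Let std_dot_gt0 x : x != 0 -> 0 < std_dot x x.
Proof.
move=> x0; rewrite lt_def; apply/andP; split; last first.
  by apply: sumr_ge0 => i _; rewrite -normCK exprn_ge0.
apply: contraNneq x0 => /eqP; rewrite psumr_eq0 => [/allP h|i _]; last first.
  by rewrite -normCK exprn_ge0.
apply/eqP/matrixP => i j; rewrite ord1 mxE.
by have := h i (mem_index_enum _); rewrite -normCK expf_eq0 normr_eq0 => /eqP.
Qed.
HB.instance Definition _ := isDotProduct.Build C 'cV[C]_n std_dot
  std_dot_gt0.

End StdDot.

Section SumDot.
Variables (U V : vectType C) (dU : {dot U for Num.conj}) (dV : {dot V for Num.conj}).
Implicit Types x y : (U * V)%type.

Definition sum_dot x y : C := dU x.1 y.1 + dV x.2 y.2.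

Let sum_dot_bilinear : bilinear_for *%R (Num.conj \; *%R) sum_dot.
Proof.
split=> u a x y /=; rewrite /sum_dot /=.
  by rewrite !linearPl mulrDr addrACA.
by rewrite !linearPr /= mulrDr addrACA.
Qed.
HB.instance Definition _ := bilinear_isBilinear.Build C (U * V)%type (U * V)%type C
  *%R (Num.conj \; *%R) sum_dot sum_dot_bilinear.

Let sum_dot_herm x y : sum_dot x y = (-1) ^+ false * (sum_dot y x)^*.
Proof.
by rewrite expr0 mul1r /sum_dot rmorphD /= (hermC dU) (hermC dV) !expr0 !mul1r.
Qed.
HB.instance Definition _ := isHermitianSesquilinear.Build C (U * V)%type
  false Num.conj sum_dot sum_dot_herm.

Let sum_dot_gt0 x : x != 0 -> 0 < sum_dot x x.
Proof.
case: x => u v uv0; rewrite /sum_dot /= lt_def addr_ge0 ?dnorm_ge0// andbT.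
apply: contraNneq uv0 => /eqP.
by rewrite paddr_eq0 ?dnorm_ge0// !dnorm_eq0 => /andP[/eqP-> /eqP->].
Qed.
HB.instance Definition _ := isDotProduct.Build C (U * V)%type sum_dot
  sum_dot_gt0.

End SumDot.

Section Adjoint.
Variables (U V : vectType C) (dU : {dot U for Num.conj}) (dV : {dot V for Num.conj}).

Definition is_adjoint (A : 'Hom(U, V)) (B : 'Hom(V, U)) : Prop :=
  forall x y, dV (A x) y = dU x (B y).

(* The default value 0 is never used, see adjointP. *)
Definition adjoint (A : 'Hom(U, V)) : 'Hom(V, U) := xget 0 [set B | is_adjoint A B].

Lemma adjointP (A : 'Hom(U, V)) : is_adjoint A (adjoint A).
Proof.
suff [B AB] : exists B, is_adjoint A B by exact: (xgetI 0 AB).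
pose e := vbasis {:U}.
pose f (x : U) : 'rV[C]_(\dim {:U}) := \row_j dU x e`_j.
pose g (y : V) : 'rV[C]_(\dim {:U}) := \row_j dV y (A e`_j).
have lf : linear f by move=> a x y; apply/rowP => j; rewrite !mxE linearPl.
have lg : linear g by move=> a x y; apply/rowP => j; rewrite !mxE linearPl.
pose F := linfun (GRing.Linear.clone _ _ _ _ f
  (HB.pack f (GRing.isLinear.Build _ _ _ _ f lf))).
pose G := linfun (GRing.Linear.clone _ _ _ _ g
  (HB.pack g (GRing.isLinear.Build _ _ _ _ g lg))).
have FE x j : F x 0 j = dU x e`_j by rewrite lfunE /= mxE.
have GE y j : G y 0 j = dV y (A e`_j) by rewrite lfunE /= mxE.
have ext (B : 'Hom(V, U)) :
    (forall y (j : 'I_(\dim {:U})), dU (B y) e`_j = dV y (A e`_j)) ->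
    is_adjoint A B.
  move=> h x y.
  have -> : dU x (B y) = (dU (B y) x)^* by rewrite (hermC dU) expr0 mul1r.
  have -> : dV (A x) y = (dV y (A x))^* by rewrite (hermC dV) expr0 mul1r.
  congr (_^*).
  rewrite (coord_vbasis (memvf x)) linear_sum !linear_sumr.
  by apply: eq_bigr => i _; rewrite linearZ !linearZr_LR /= h.
have kF : lker F == 0%VS.
  apply/lker0P => x y Fxy; apply/eqP; rewrite -subr_eq0 -(dnorm_eq0 dU).
  set z := x - y.
  have hz (j : 'I_(\dim {:U})) : dU z e`_j = 0.
    by rewrite -FE /z linearB /= Fxy subrr mxE.
  rewrite {2}(coord_vbasis (memvf z)) linear_sumr big1// => i _.
  by rewrite linearZr_LR /= hz mulr0.
have lF : limg F = fullv.
  apply/eqP; rewrite eqEdim subvf limg_dim_eq; last first.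
    by apply/eqP; rewrite (eqP kF) capv0.
  by rewrite !dimvf /dim /= mul1n.
exists (F^-1 \o G)%VF; apply: ext => y j.
by rewrite -FE comp_lfunE limg_lfunVK ?lF ?memvf// GE.
Qed.

End Adjoint.

Section Operators.
Variables (H : vectType C) (dH : {dot H for Num.conj}).

Definition im_op (T : 'End(H)) : 'End(H) :=
  (2 * 'i)^-1 *: (T - adjoint dH dH T).

Definition resolvent_set (T : 'End(H)) : set C :=
  [set z | exists S : 'End(H),
     ((T - z *: \1) \o S = \1)%VF /\ (S \o (T - z *: \1) = \1)%VF].

(* Column convention: column j of A holds the coordinates of T (e j). *)
Definition has_matrix n (e : n.-tuple H) (T : 'End(H)) (A : 'M[C]_n) : Prop :=
  forall j, T (tnth e j) = \sum_i A i j *: tnth e i.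

End Operators.

Definition diag2 (a b : C) : 'M[C]_2 := diag_mx (\row_j if j == 0 then a else b).

Definition mx_op n (A : 'M[C]_n) : 'End('cV[C]_n) := linfun (mulmx A).

Record array (H E : vectType C) := Array {
  main_op : 'End(H);
  channel_op : 'Hom(E, H);
  directing_op : 'End(E) }.

Section Lsystem.
Variables (H E : vectType C) (dH : {dot H for Num.conj}) (dE : {dot E for Num.conj}).
Implicit Type Th : array H E.

Record is_Lsystem Th : Prop := {
  directing_selfadjoint : adjoint dE dE (directing_op Th) = directing_op Th;
  directing_unitaryl :
    (adjoint dE dE (directing_op Th) \o directing_op Th = \1)%VF;
  directing_unitaryr :
    (directing_op Th \o adjoint dE dE (directing_op Th) = \1)%VF;
  im_main_op : im_op dH (main_op Th) =
    (channel_op Th \o directing_op Th \o adjoint dE dH (channel_op Th))%VF }.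

(* f^-1 is the inverse operator when f is invertible, so the value is
   meaningful only for z in resolvent_set (main_op Th). *)
Definition transfer Th (z : C) : 'End(E) :=
  (\1 - (2 * 'i) *: (adjoint dE dH (channel_op Th) \o (main_op Th - z *: \1)^-1 \o
                     channel_op Th \o directing_op Th))%VF.

End Lsystem.

Section Coupling.
Variables (H1 H2 E : vectType C) (dH2 : {dot H2 for Num.conj}) (dE : {dot E for Num.conj}).

(* J is read off Th1; the coupling is meant for two arrays sharing the same
   directing operator. *)
Definition coupling (Th1 : array H1 E) (Th2 : array H2 E) : array (H1 * H2)%type E :=
  let T1 := main_op Th1 in let K1 := channel_op Th1 in
  let T2 := main_op Th2 in let K2 := channel_op Th2 in
  let J := directing_op Th1 in
  Array
    (linfun (fun h : H1 * H2 =>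
       (T1 h.1 + (2 * 'i) *: K1 (J (adjoint dE dH2 K2 h.2)), T2 h.2)))
    (linfun (fun c : E => (K1 c, K2 c)))
    J.

Lemma coupling_mainE (Th1 : array H1 E) (Th2 : array H2 E) (h : H1 * H2) :
  main_op (coupling Th1 Th2) h =
  (main_op Th1 h.1 + (2 * 'i) *: channel_op Th1
     (directing_op Th1 (adjoint dE dH2 (channel_op Th2) h.2)),
   main_op Th2 h.2).
Proof.
rewrite /coupling /=; set f := fun _ => _.
have lf : linear f.
  move=> a x y; rewrite /f /= !linearP /=; congr pair.
  by rewrite addrACA -scalerDr.
pose F := GRing.Linear.clone _ _ _ _ f
  (HB.pack f (GRing.isLinear.Build _ _ _ _ f lf)).
exact: (lfunE F).
Qed.

Lemma coupling_channelE (Th1 : array H1 E) (Th2 : array H2 E) (c : E) :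
  channel_op (coupling Th1 Th2) c = (channel_op Th1 c, channel_op Th2 c).
Proof.
rewrite /coupling /=; set f := fun _ => _.
have lf : linear f by move=> a x y; rewrite /f /= !linearP.
pose F := GRing.Linear.clone _ _ _ _ f
  (HB.pack f (GRing.isLinear.Build _ _ _ _ f lf)).
exact: (lfunE F).
Qed.

End Coupling.
End Hilbert.

(* Main.v *)
Require Import Defs.
Import Order.TTheory GRing.Theory Num.Theory.
Local Open Scope ring_scope.
Local Open Scope classical_set_scope.

(** Why the theorem holds.  Everything about the coupling is true of any two
    L-systems with the same directing operator J.  Write A_j for
    K_j^* (T_j - z)^-1 K_j J, so that the transfer functions are
    W_j = 1 - 2i A_j.  The main operator of the coupling is block triangular,
    hence (T - z)(x, y) = (u, v) is solved by back substitution: first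
    y = (T_2 - z)^-1 v, then x = (T_1 - z)^-1 (u - 2i K_1 J K_2^* y).  With
    (u, v) = (K_1 J c, K_2 J c) the second step reads
    x = (T_1 - z)^-1 K_1 J (1 - 2i A_2) c, so the signal entering the first
    system is the output W_2 c of the second one, and adding the two channel
    contributions gives W c = W_2 c - 2i A_1 W_2 c = W_1 W_2 c
    ([transfer_coupling]).  That the coupling is again an L-system
    ([coupling_Lsystem]) is the same triangular computation for T - T^*: the
    two off-diagonal blocks are the cross terms of K J K^*.

    For a single system everything is diagonal in the orthonormal basis e_j,
    with T e_j = d_j e_j, the channel maps the j-th unit vector to k_j e_j, and
    k_j^2 = Im d_j, so the transfer function acts on
    the j-th coordinate as
    1 - 2i (Im d_j) / (d_j - z) = (conj d_j - z) / (d_j - z)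
    ([transfer_diag]).  The product of the two diagonal matrices is the matrix
    in the statement. *)

Set Implicit Arguments.
Unset Strict Implicit.
Unset Printing Implicit Defensive.

(** * Adjoints *)

Section AdjointTheory.
Variable C : numClosedFieldType.
Implicit Types U V : vectType C.

Lemma dot_conj V (d : {dot V for Num.conj}) (x y : V) : d x y = (d y x)^*.
Proof. by rewrite (hermC d) expr0 mul1r. Qed.

Lemma dot_injr V (d : {dot V for Num.conj}) (x y : V) :
  (forall u, d u x = d u y) -> x = y.
Proof.
move=> dxy; apply/eqP; rewrite -subr_eq0 -(dnorm_eq0 d); apply/eqP.
by rewrite linearBr /= dxy subrr.
Qed.

Variables (U V : vectType C).
Variables (dU : {dot U for Num.conj}) (dV : {dot V for Num.conj}).

Lemma dot_adjointr (A : 'Hom(U, V)) x y : dU x (adjoint dU dV A y) = dV (A x) y.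
Proof. by rewrite (adjointP dU dV). Qed.

Lemma dot_adjointl (A : 'Hom(U, V)) x y : dU (adjoint dU dV A y) x = dV y (A x).
Proof. by rewrite dot_conj dot_adjointr -dot_conj. Qed.

(** The candidate [g] is a bare function: a formula for an adjoint can be
    checked without proving first that it is linear. *)
Lemma adjointE (A : 'Hom(U, V)) (g : V -> U) :
  (forall x y, dV (A x) y = dU x (g y)) -> adjoint dU dV A =1 g.
Proof. by move=> Ag y; apply: (@dot_injr U dU) => x; rewrite -Ag dot_adjointr. Qed.

End AdjointTheory.

Section SelfAdjoint.
Variables (C : numClosedFieldType) (U : vectType C) (dU : {dot U for Num.conj}).

Lemma adjoint1 : adjoint dU dU \1%VF = \1%VF.
Proof. by apply/lfunP; apply: adjointE => x y; rewrite !id_lfunE. Qed.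

Lemma im_opE (T : 'End(U)) x :
  im_op dU T x = (2 * 'i)^-1 *: (T x - adjoint dU dU T x).
Proof. by rewrite scale_lfunE add_lfunE opp_lfunE. Qed.

End SelfAdjoint.

(** * Resolvents *)

Section Resolvent.
Variables (C : numClosedFieldType) (H : vectType C).
Implicit Types T : 'End(H).

Lemma sub_scale1E T (z : C) x : (T - z *: \1)%VF x = T x - z *: x.
Proof. by rewrite add_lfunE opp_lfunE scale_lfunE id_lfunE. Qed.

(** In finite dimension an injective endomorphism is invertible, so the
    resolvent set is the complement of the set of eigenvalues. *)
Lemma resolventP T z :
  resolvent_set T z <-> (forall x, T x = z *: x -> x = 0).
Proof.
split=> [[S [_ ST]] x Tx|inj].
  by rewrite -[x]id_lfunE -ST comp_lfunE sub_scale1E Tx subrr linear0.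
have ker0 : lker (T - z *: \1)%VF == 0%VS.
  apply/lker0P => x y; rewrite !sub_scale1E => Exy.
  apply/eqP; rewrite -subr_eq0; apply/eqP/inj.
  rewrite linearB /= scalerBr -[T x](subrK (z *: x)) Exy.
  by rewrite addrAC [T y - _]addrC addrK addrC.
by exists (T - z *: \1)^-1%VF; rewrite lker0_compfV// lker0_compVf.
Qed.

(** The inverse [^-1] of a linear map is a total operation, only a generalised
    inverse in general; this lemma and the next tie it to the resolvent. *)
Lemma resolventKr T z x : resolvent_set T z ->
  T ((T - z *: \1)^-1%VF x) - z *: (T - z *: \1)^-1%VF x = x.
Proof.
rewrite -sub_scale1E => -[S [TS ST]]; apply: lker0_lfunVK.
by apply/lker0P/(can_inj (g := S)) => y; rewrite -comp_lfunE ST id_lfunE.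
Qed.

(** Reduces the computation of a resolvent to checking a guessed preimage. *)
Lemma resolvent_eq T z x y : resolvent_set T z ->
  T y - z *: y = x -> (T - z *: \1)^-1%VF x = y.
Proof.
move=> rz; rewrite -sub_scale1E => <-; case: rz => [S [_ ST]].
apply: lker0_lfunK; apply/lker0P/(can_inj (g := S)) => u.
by rewrite -comp_lfunE ST id_lfunE.
Qed.

End Resolvent.

(** * Couplings *)

Lemma transferE (C : numClosedFieldType) (H E : vectType C)
    (dH : {dot H for Num.conj}) (dE : {dot E for Num.conj})
    (Th : array H E) z c :
  transfer dH dE Th z c = c - (2 * 'i) *: adjoint dE dH (channel_op Th)
    ((main_op Th - z *: \1)^-1%VF (channel_op Th (directing_op Th c))).
Proof. by rewrite add_lfunE id_lfunE opp_lfunE scale_lfunE !comp_lfunE. Qed.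

Section CouplingTheory.
Variables (C : numClosedFieldType) (H1 H2 E : vectType C).
Variables (dH1 : {dot H1 for Num.conj}) (dH2 : {dot H2 for Num.conj}).
Variable dE : {dot E for Num.conj}.
Variables (Th1 : array H1 E) (Th2 : array H2 E).

Let T1 := main_op Th1.
Let T2 := main_op Th2.
Let K1 := channel_op Th1.
Let K2 := channel_op Th2.
Let J := directing_op Th1.
Let Th := coupling dH2 dE Th1 Th2.
Let dH : {dot (H1 * H2)%type for Num.conj} := sum_dot dH1 dH2.

Lemma coupling_channel_adjoint h :
  adjoint dE dH (channel_op Th) h =
  adjoint dE dH1 K1 h.1 + adjoint dE dH2 K2 h.2.
Proof.
move: h; apply: adjointE => c h.
by rewrite coupling_channelE /dH /= /sum_dot /= linearDr /= !dot_adjointr.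
Qed.

(** The off-diagonal block 2i K_1 J K_2^* moves below the diagonal as
    -2i K_2 J K_1^*: conjugation changes the sign of 2i and reverses the
    product, J being selfadjoint. *)
Lemma coupling_main_adjoint h : adjoint dE dE J = J ->
  adjoint dH dH (main_op Th) h =
  (adjoint dH1 dH1 T1 h.1,
   adjoint dH2 dH2 T2 h.2 - (2 * 'i) *: K2 (J (adjoint dE dH1 K1 h.1))).
Proof.
move=> Jsa; move: h; apply: adjointE => x y.
rewrite coupling_mainE /dH /= /sum_dot /= linearDl linearBr /= linearZl_LR linearZr_LR /=.
rewrite !dot_adjointr -addrA; congr (_ + _); rewrite addrC; congr (_ + _).
rewrite -(dot_adjointr dE) -(dot_adjointr dE) Jsa dot_adjointl.
by rewrite rmorphM /= conjCi rmorph_nat mulrN mulNr opprK.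
Qed.

(** Divided by 2i, the off-diagonal blocks of T and -T^* are K_1 J K_2^* and
    K_2 J K_1^*, the cross terms in the expansion of K J K^*. *)
Lemma coupling_Lsystem : directing_op Th2 = J ->
  is_Lsystem dH1 dE Th1 -> is_Lsystem dH2 dE Th2 -> is_Lsystem dH dE Th.
Proof.
move=> J2 [Jsa Jl Jr im1] [_ _ _ im2]; split=> //.
have i2_unit : 2 * 'i != 0 :> C by rewrite mulf_neq0 ?pnatr_eq0 ?neq0Ci.
apply/lfunP => -[x y]; rewrite im_opE coupling_mainE coupling_main_adjoint//.
rewrite !comp_lfunE coupling_channelE coupling_channel_adjoint /= !linearD /=.
have /(congr1 (fun f : 'End(H1) => f x)) := im1.
have /(congr1 (fun f : 'End(H2) => f y)) := im2.
rewrite !im_opE !comp_lfunE J2 => <- <-; congr pair => /=.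
  by rewrite -scalerDr addrAC scalerDr scalerK.
by rewrite -scalerDr opprB addrCA scalerDr scalerK.
Qed.

(** A block triangular operator has no eigenvalues besides those of its
    diagonal blocks. *)
Lemma resolvent_coupling z :
  resolvent_set T1 z -> resolvent_set T2 z -> resolvent_set (main_op Th) z.
Proof.
move=> /resolventP r1 /resolventP r2; apply/resolventP => -[x y].
rewrite coupling_mainE => -[/= Ex /r2 y0]; move: Ex.
by rewrite y0 !linear0 addr0 => /r1 ->.
Qed.

(** Back substitution in the triangular system: the first system receives
    the output of the second one instead of the input c. *)
Lemma transfer_coupling z : directing_op Th2 = J ->
  resolvent_set T1 z -> resolvent_set T2 z ->
  transfer dH dE Th z = (transfer dH1 dE Th1 z \o transfer dH2 dE Th2 z)%VF.
Proof.
move=> J2 r1 r2; apply/lfunP => c; rewrite comp_lfunE !transferE.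
rewrite coupling_channelE -/J J2 -/K1 -/K2 -/T1 -/T2.
(* The argument of J in x is the output of Th2 on the input c. *)
set y := (T2 - z *: \1)^-1%VF (K2 (J c)).
set x := (T1 - z *: \1)^-1%VF
  (K1 (J (c - (2 * 'i) *: adjoint dE dH2 K2 y))).
rewrite (@resolvent_eq _ _ _ _ _ (x, y)); last 2 first.
- exact: resolvent_coupling.
- rewrite coupling_mainE -/J -/K1 -/K2 -/T1 -/T2 /=; congr pair; last exact: resolventKr.
  by rewrite addrAC resolventKr// !linearB !linearZ /= scalerN subrK.
have -> := coupling_channel_adjoint (x, y).
by rewrite /= scalerDr opprD addrA addrAC.
Qed.

End CouplingTheory.

(** * Diagonal L-systems *)

Lemma sub_conjC (C : numClosedFieldType) (x : C) : x - x^* = 2 * 'i * 'Im x.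
Proof.
rewrite ImE !mulrA -(mulrA 2) -expr2 sqrCi mulrN1 mulNr -mulrN opprB.
by rewrite mulrAC divff ?mul1r// pnatr_eq0.
Qed.

Lemma lfun_eq_delta (K : fieldType) n (V : vectType K) (f g : 'Hom('cV[K]_n, V)) :
  (forall j, f (delta_mx j 0) = g (delta_mx j 0)) -> f = g.
Proof.
move=> fg; apply/lfunP => c; rewrite (matrix_sum_delta c) !linear_sum.
by apply: eq_bigr => i _; rewrite big_ord1 !linearZ /= fg.
Qed.

Lemma mx_op_comp (C : numClosedFieldType) n (A B : 'M[C]_n) :
  (mx_op A \o mx_op B)%VF = mx_op (A *m B).
Proof. by apply/lfunP => c; rewrite comp_lfunE !lfunE /= mulmxA. Qed.

Section Diagonal.
Variables (C : numClosedFieldType) (n : nat) (H : vectType C).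
Variables (dH : {dot H for Num.conj}) (e : n.-tuple H).
Hypothesis e_basis : basis_of fullv e.
Hypothesis e_orthonormal : orthonormal dH e.

Lemma dot_basis i j : dH (tnth e i) (tnth e j) = (i == j)%:R.
Proof.
have [uniq_e ->] := orthonormalP e_orthonormal; rewrite ?mem_tnth//.
by rewrite !(tnth_nth 0) nth_uniq ?size_tuple.
Qed.

Lemma lfun_eq_basis (V : vectType C) (f g : 'Hom(H, V)) :
  (forall j, f (tnth e j) = g (tnth e j)) -> f = g.
Proof.
move=> fg; apply/lfunP => x; rewrite (coord_basis e_basis (memvf x)) !linear_sum.
by apply: eq_bigr => i _; rewrite !linearZ /= -tnth_nth fg.
Qed.

Lemma dot_injr_basis x y : (forall i, dH (tnth e i) x = dH (tnth e i) y) -> x = y.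
Proof.
move=> exy; apply: (@dot_injr _ _ dH) => u.
rewrite (coord_basis e_basis (memvf u)) !linear_sumlz.
by apply: eq_bigr => i _; rewrite !linearZl_LR /= -tnth_nth exy.
Qed.

Variables (d : 'rV[C]_n) (T : 'End(H)).
Hypothesis TE : has_matrix e T (diag_mx d).

Lemma diag_mainE j : T (tnth e j) = d 0 j *: tnth e j.
Proof.
rewrite TE (bigD1 j)//= big1 => [|i ij]; rewrite !mxE ?eqxx ?mulr1n ?addr0//.
by rewrite (negPf ij) mulr0n scale0r.
Qed.

(** The adjoint of an operator diagonal in a basis is diagonal in the dual
    basis, which for an orthonormal basis is the basis itself. *)
Lemma diag_main_adjoint j : adjoint dH dH T (tnth e j) = (d 0 j)^* *: tnth e j.
Proof.
apply: dot_injr_basis => i; rewrite dot_adjointr diag_mainE.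
rewrite linearZl_LR linearZr_LR /= conjCK dot_basis.
by case: eqP => [->|_] //=; rewrite !mulr0.
Qed.

Lemma resolvent_diag z : resolvent_set T z <-> forall j, d 0 j != z.
Proof.
rewrite resolventP; split=> [inj j|dz x Tx].
  apply/eqP => djz; have := dot_basis j j.
  rewrite (inj (tnth e j)) ?diag_mainE ?djz// linear0l eqxx => /esym/eqP.
  by rewrite oner_eq0.
apply: dot_injr_basis => i; rewrite linear0r dot_conj.
(* The i-th coordinate of T x = z x, computed by moving T across. *)
have /eqP : dH (T x) (tnth e i) = d 0 i * dH x (tnth e i).
  by rewrite -(dot_adjointr dH) diag_main_adjoint linearZr_LR /= conjCK.
rewrite Tx linearZl_LR /= -subr_eq0 -mulrBl mulf_eq0 subr_eq0 eq_sym.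
by rewrite (negPf (dz i)) /= => /eqP ->; rewrite conjC0.
Qed.

(* K^* has the coefficients k_j themselves, not their conjugates: this is the
   case of real k_j, that is Im d_j >= 0. *)
Variables (K : 'Hom('cV[C]_n, H)) (k : 'I_n -> C).
Hypothesis KE : forall j, K (delta_mx j 0) = k j *: tnth e j.
Hypothesis KadjE : forall j,
  adjoint (@std_dot C n) dH K (tnth e j) = k j *: delta_mx j 0.
Hypothesis k_sqr : forall j, k j ^+ 2 = 'Im (d 0 j).

(** Both sides of Im T = K J K^* multiply the j-th basis vector by Im d_j. *)
Lemma Lsystem_diag : is_Lsystem dH (@std_dot C n) (Array T K \1%VF).
Proof.
split; rewrite /= ?adjoint1 ?comp_lfun1l ?comp_lfun1r//.
apply: lfun_eq_basis => j; rewrite comp_lfunE KadjE.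
rewrite [RHS]linearZ /= KE im_opE diag_mainE diag_main_adjoint.
rewrite -scalerBl sub_conjC !scalerA.
by rewrite mulKf ?mulf_neq0 ?pnatr_eq0 ?neq0Ci// -k_sqr expr2.
Qed.

(** The j-th eigenvalue is 1 - 2i k_j^2 / (d_j - z), and
    d_j - z - 2i Im d_j is conj d_j - z. *)
Lemma transfer_diag z : resolvent_set T z ->
  transfer dH (@std_dot C n) (Array T K \1%VF) z =
  mx_op (diag_mx (\row_j (((d 0 j)^* - z) / (d 0 j - z)))).
Proof.
move=> rz; apply: lfun_eq_delta => j; rewrite transferE /= id_lfunE KE.
have dz : d 0 j - z != 0 by rewrite subr_eq0; move/resolvent_diag: rz.
rewrite (resolvent_eq (y := (k j / (d 0 j - z)) *: tnth e j))//; last first.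
  rewrite linearZ /= diag_mainE !scalerA -scalerBl [z * _]mulrC -mulrBr.
  by rewrite divfK.
rewrite [adjoint _ _ _ _]linearZ /= KadjE !scalerA lfunE /=.
transitivity ((((d 0 j)^* - z) / (d 0 j - z)) *: delta_mx j 0 : 'cV[C]_n).
  rewrite -{1}[delta_mx j 0]scale1r -scalerBl; congr (_ *: _).
  have -> : (d 0 j)^* - z = d 0 j - z - 2 * 'i * 'Im (d 0 j).
    by rewrite -sub_conjC opprB [RHS]addrC addrA subrK.
  by rewrite mulrBl divff// -k_sqr expr2 !mulrA [_ / _ * _]mulrAC.
apply/matrixP => a b; rewrite mul_diag_mx !mxE.
by case: eqP => [->|_] //=; rewrite !mulr0.
Qed.

End Diagonal.

Lemma ord2P (P : 'I_2 -> Prop) : P 0 -> P 1 -> forall j, P j.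
Proof.
move=> P0 P1 [[|[|//]] lt_j].
  by rewrite (_ : Ordinal _ = 0) //; apply: val_inj.
by rewrite (_ : Ordinal _ = 1) //; apply: val_inj.
Qed.

(** The formulas for K and K^* in coordinates are those of a diagonal channel
    with coefficients the square roots of Im l and Im m. *)
Section Planar.
Variables (C : numClosedFieldType) (H : vectType C) (dH : {dot H for Num.conj}).
Hypothesis dimH : \dim {:H}%VS = 2%N.
Variables h01 h02 : H.
Hypothesis onH : orthonormal dH [:: h01; h02].
Let e := [tuple h01; h02].

Let e_basis : basis_of fullv e.
Proof. by rewrite basisEfree dimH subvf (orthonormal_free onH). Qed.

Variables (l m : C) (T : 'End(H)).
Hypothesis TE : has_matrix e T (diag2 l m).

Lemma resolvent_diag2 z : resolvent_set T z <-> l != z /\ m != z.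
Proof.
rewrite (resolvent_diag e_basis onH TE).
split=> [dz|[lz mz]]; first by have := (dz 0, dz 1); rewrite !mxE => -[].
by apply: ord2P; rewrite mxE.
Qed.

Variable K : 'Hom('cV[C]_2, H).
Hypothesis Kc : forall c : 'cV[C]_2,
  K c = (sqrtC ('Im l) * c 0 0) *: h01 + (sqrtC ('Im m) * c 1 0) *: h02.
Hypothesis Kadjc : forall c1 c2 : C,
  adjoint (@std_dot C 2) dH K (c1 *: h01 + c2 *: h02) =
  \col_i (if i == 0 then sqrtC ('Im l) * c1 else sqrtC ('Im m) * c2).

Let d : 'rV[C]_2 := \row_j (if j == 0 then l else m).
Let k (j : 'I_2) : C := sqrtC ('Im (d 0 j)).

Let KE j : K (delta_mx j 0) = k j *: tnth e j.
Proof.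
move: j; apply: ord2P; rewrite Kc /k !mxE /= (tnth_nth 0) /=.
  by rewrite mulr1 mulr0 scale0r addr0.
by rewrite mulr1 mulr0 scale0r add0r.
Qed.

Let KadjE j : adjoint (@std_dot C 2) dH K (tnth e j) = k j *: delta_mx j 0.
Proof.
move: j; apply: ord2P; rewrite (tnth_nth 0) /=.
  have := Kadjc 1 0; rewrite scale1r scale0r addr0 => ->.
  by apply/colP; apply: ord2P; rewrite /k !mxE /= ?mulr1 ?mulr0.
have := Kadjc 0 1; rewrite scale1r scale0r add0r => ->.
by apply/colP; apply: ord2P; rewrite /k !mxE /= ?mulr1 ?mulr0.
Qed.

Let k_sqr j : k j ^+ 2 = 'Im (d 0 j).
Proof. exact: sqrtCK. Qed.

Lemma Lsystem_diag2 : is_Lsystem dH (@std_dot C 2) (Array T K \1%VF).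
Proof. exact: (Lsystem_diag e_basis onH TE KE KadjE k_sqr). Qed.

Lemma transfer_diag2 z : resolvent_set T z ->
  transfer dH (@std_dot C 2) (Array T K \1%VF) z =
  mx_op (diag2 ((l^* - z) / (l - z)) ((m^* - z) / (m - z))).
Proof.
move=> rz; rewrite (transfer_diag e_basis onH TE KE KadjE k_sqr rz).
by congr (mx_op (diag_mx _)); apply/rowP; apply: ord2P; rewrite !mxE.
Qed.

End Planar.

Theorem theorem12 (R : realType)
  (H : vectType R[i]) (dH : {dot H for Num.conj})
  (dimH : \dim {:H}%VS = 2%N)
  (h01 h02 : H) (onH : orthonormal dH [:: h01; h02])
  (l1 l2 m1 m2 : R[i]) (l1_gt0 : 0 < 'Im l1) (l2_gt0 : 0 < 'Im l2)
  (T1 T2 : 'End(H))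
  (T1E : has_matrix [tuple h01; h02] T1 (diag2 l1 m1))
  (T2E : has_matrix [tuple h01; h02] T2 (diag2 l2 m2))
  (K1 K2 : 'Hom('cV[R[i]]_2, H))
  (K1E : forall c : 'cV[R[i]]_2,
     K1 c = (sqrtC ('Im l1) * c 0 0) *: h01 + (sqrtC ('Im m1) * c 1 0) *: h02)
  (K2E : forall c : 'cV[R[i]]_2,
     K2 c = (sqrtC ('Im l2) * c 0 0) *: h01 + (sqrtC ('Im m2) * c 1 0) *: h02)
  (K1adjE : forall c1 c2 : R[i],
     adjoint (@std_dot R[i] 2) dH K1 (c1 *: h01 + c2 *: h02) =
     \col_i (if i == 0 then sqrtC ('Im l1) * c1 else sqrtC ('Im m1) * c2))
  (K2adjE : forall c1 c2 : R[i],
     adjoint (@std_dot R[i] 2) dH K2 (c1 *: h01 + c2 *: h02) =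
     \col_i (if i == 0 then sqrtC ('Im l2) * c1 else sqrtC ('Im m2) * c2)) :
  let dE := @std_dot R[i] 2 in
  let Th1 := Array T1 K1 \1%VF in
  let Th2 := Array T2 K2 \1%VF in
  let Th := coupling dH dE Th1 Th2 in
  [/\ is_Lsystem dH dE Th1,
      is_Lsystem dH dE Th2,
      is_Lsystem (sum_dot dH dH) dE Th,
      resolvent_set T1 `&` resolvent_set T2 = ~` [set l1; l2; m1; m2] &
      forall z : R[i], z \in resolvent_set T1 `&` resolvent_set T2 ->
        [/\ z \in resolvent_set (main_op Th),
            transfer (sum_dot dH dH) dE Th z =
              (transfer dH dE Th1 z \o transfer dH dE Th2 z)%VF &
            transfer (sum_dot dH dH) dE Th z =
              mx_op (diag2 ((l1^* - z) / (l1 - z) * ((l2^* - z) / (l2 - z)))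
                           ((m1^* - z) / (m1 - z) * ((m2^* - z) / (m2 - z))))]].
Proof.
move=> dE Th1 Th2 Th.
have L1 : is_Lsystem dH dE Th1 by exact: (Lsystem_diag2 dimH onH T1E).
have L2 : is_Lsystem dH dE Th2 by exact: (Lsystem_diag2 dimH onH T2E).
have rho1 := resolvent_diag2 dimH onH T1E.
have rho2 := resolvent_diag2 dimH onH T2E.
split=> //; first exact: coupling_Lsystem.
  apply/seteqP; split=> z /=.
    move=> [/rho1[l1z m1z] /rho2[l2z m2z]].
    by move=> [[[]|]|] ez; move: l1z l2z m1z m2z; rewrite ez eqxx.
  by move=> zP; split; [apply/rho1|apply/rho2]; split;
    apply/eqP => ez; apply: zP; rewrite -ez; tauto.
move=> z /set_mem[r1 r2].
have WE : transfer (sum_dot dH dH) dE Th z =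
    (transfer dH dE Th1 z \o transfer dH dE Th2 z)%VF.
  exact: transfer_coupling.
split=> //; first by apply/mem_set/resolvent_coupling.
rewrite WE (transfer_diag2 dimH onH T1E K1E K1adjE r1).
rewrite (transfer_diag2 dimH onH T2E K2E K2adjE r2).
rewrite mx_op_comp mulmx_diag; congr (mx_op (diag_mx _)).
by apply/rowP; apply: ord2P; rewrite !mxE.
Qed.
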